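(* Suppose $T_1'$ and $T_2'$ are $n$-leaf binary trees with a common parse word. Extend each tree by attaching the $2$-leaf binary tree to leaf $i$, obtaining $T_1$ and $T_2$ respectively. Then \[|\mathrm{ParseWords}(T_1, T_2)| = 2\, |\mathrm{ParseWords}(T_1', T_2')|.\] In particular, $T_1$ and $T_2$ have a common parse word.
   Context: A binary tree is a rooted ordered tree in which each vertex has either $0$ or $2$ children; its leaves are numbered $1,2,\dots$ from left to right, and leaf $i$ denotes the $i$th leaf (the same $i$, with $1\le i\le n$, is used for both trees). Let $G$ be the context-free grammar with start symbols $0,1,2$ and rules $0\to 12$, $0\to 21$, $1\to 02$, $1\to 20$, $2\to 01$, $2\to 10$. An $n$-leaf binary tree $T$ parses a word $w$ of length $n$ on $\{0,1,2\}$ if there is a labeling of the vertices of $T$ by $0,1,2$ such that the leaves, from left to right, are labeled with the letters of $w$, and at every internal vertex the label of the vertex together with the labels of its left and right children form a rule of $G$ (i.e. the three labels are pairwise distinct). A common parse word of two $n$-leaf trees is a word parsed by both. If $T$ parses $w$, it also parses every word obtained from $w$ by permuting the alphabet $\{0,1,2\}$. For two binary trees $S_1,S_2$ with the same number of leaves, $\mathrm{ParseWords}(S_1,S_2)$ denotes the set of equivalence classes (under permutations of the alphabet $\{0,1,2\}$) of words parsed by both $S_1$ and $S_2$. Attaching the $2$-leaf binary tree to leaf $i$ means replacing leaf $i$ by an internal vertex whose two children are leaves.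
   Formalization: The equality is stated only for n ≥ 2, since for n = 1 both sets of parse words have exactly one class and the equality fails; that the extended trees have a common parse word is stated for all n ≥ 1. *)

(* Defs.v *)
From mathcomp Require Import all_boot all_fingroup.

Set Implicit Arguments.
Unset Strict Implicit.
Unset Printing Implicit Defensive.

Inductive btree : Type := Leaf | Node of btree & btree.

Fixpoint nleaves (T : btree) : nat :=
  if T is Node l r then nleaves l + nleaves r else 1.

(* The vertices of [Node l r] are its root [None], the vertices of [l] and
   those of [r]. *)
Fixpoint vertex (T : btree) : finType :=
  match T with
  | Leaf => unit
  | Node l r => option (vertex l + vertex r)%type
  end.

Definition in_left (l r : btree) (v : vertex l) : vertex (Node l r) :=
  Some (inl v).

Definition in_right (l r : btree) (v : vertex r) : vertex (Node l r) :=
  Some (inr v).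

Definition root_vertex (T : btree) : vertex T :=
  match T return vertex T with
  | Leaf => tt
  | Node _ _ => None
  end.

Fixpoint leaf_vertices (T : btree) : seq (vertex T) :=
  match T return seq (vertex T) with
  | Leaf => [:: tt]
  | Node l r => [seq in_left r v | v <- leaf_vertices l]
                ++ [seq in_right l v | v <- leaf_vertices r]
  end.

Definition letter := 'I_3.

(* The triple (a, b, c) is the rule a -> b c. *)
Definition grammar : seq (nat * nat * nat) :=
  [:: (0, 1, 2); (0, 2, 1); (1, 0, 2); (1, 2, 0); (2, 0, 1); (2, 1, 0)].

Definition is_rule (a b c : letter) : bool :=
  (val a, val b, val c) \in grammar.

Fixpoint obeys_grammar (T : btree) : (vertex T -> letter) -> bool :=
  match T return (vertex T -> letter) -> bool with
  | Leaf => fun _ => true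
  | Node l r => fun f =>
      [&& is_rule (f (root_vertex (Node l r)))
                  (f (in_left r (root_vertex l)))
                  (f (in_right l (root_vertex r))),
          obeys_grammar (fun v => f (in_left r v))
        & obeys_grammar (fun v => f (in_right l v))]
  end.

(* The root label is unconstrained: 0, 1 and 2 are all start symbols. *)
Definition parses (T : btree) (w : seq letter) : bool :=
  [exists f : {ffun vertex T -> letter},
     obeys_grammar f && ([seq f v | v <- leaf_vertices T] == w)].

Definition common_parse_word (S1 S2 : btree) (w : seq letter) : bool :=
  parses S1 w && parses S2 w.

Definition word_class (n : nat) (w : n.-tuple letter) :
    {set n.-tuple letter} :=
  [set map_tuple s w | s : {perm letter}].

(* Restricting to words of length [nleaves S1] loses nothing, since every word
   parsed by [S1] has that length. *)
Definition ParseWords (S1 S2 : btree) :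
    {set {set (nleaves S1).-tuple letter}} :=
  [set word_class w | w : (nleaves S1).-tuple letter
                    & common_parse_word S1 S2 w].

(* Leaves are numbered from 1; if [T] has no leaf [i] then [attach T i = T]. *)
Fixpoint attach (T : btree) (i : nat) : btree :=
  match T with
  | Leaf => if i == 1 then Node Leaf Leaf else Leaf
  | Node l r => if i <= nleaves l then Node (attach l i) r
                else Node l (attach r (i - nleaves l))
  end.

(* Main.v *)
Require Import Defs.
From mathcomp Require Import all_boot all_fingroup.

(** If a tree parses a word of length at least 2, that word contains two
    distinct letters (a lowest internal vertex has two leaf children), so its
    class under the six permutations of the alphabet has exactly six elements.
    Hence the number of common parse words is six times the number of classes,
    and it suffices to count words.  A word is parsed by the extended tree iff
    it arises from a word parsed by the original tree by replacing the [i]th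
    letter [c] by one of the two words [xy] such that [c -> xy] is a rule; this
    replacement does not depend on the tree and is injective. *)

(** * Derivations of words and their symmetry under letter permutations *)

Lemma is_ruleE (a b c : letter) :
  is_rule a b c = [&& a != b, b != c & a != c].
Proof.
by case: a b c => [[|[|[|//]]] ?] [[|[|[|//]]] ?] [[|[|[|//]]] ?].
Qed.

Lemma is_rule_perm (s : {perm letter}) (a b c : letter) :
  is_rule (s a) (s b) (s c) = is_rule a b c.
Proof. by rewrite !is_ruleE !(inj_eq perm_inj). Qed.

(** Forgets the vertex labeling and keeps only the root letter and the leaf word, so that inductions
    split the word along the tree; [parsesP] ties this to [parses]. *)
Inductive derives : btree -> letter -> seq letter -> Prop :=
| derives_Leaf a : derives Leaf a [:: a]
| derives_Node l r a b c u v :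
    is_rule a b c -> derives l b u -> derives r c v ->
    derives (Node l r) a (u ++ v).

Lemma derives_LeafE {a w} : derives Leaf a w -> w = [:: a].
Proof. by move=> d; inversion d. Qed.

Lemma derives_NodeE {l r a w} : derives (Node l r) a w ->
  exists b c u v,
    [/\ is_rule a b c, derives l b u, derives r c v & w = u ++ v].
Proof. by move=> d; inversion d; exists b, c, u, v. Qed.

Lemma obeys_grammar_ext (T : btree) (f g : vertex T -> letter) :
  f =1 g -> obeys_grammar f = obeys_grammar g.
Proof.
elim: T f g => [//|l IHl r IHr] f g fg /=.
by rewrite !fg; congr [&& _, _ & _]; [apply: IHl | apply: IHr] => v; apply: fg.
Qed.

Lemma obeys_derives (T : btree) (f : vertex T -> letter) :
  obeys_grammar f ->
  derives T (f (root_vertex T)) [seq f v | v <- leaf_vertices T].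
Proof.
elim: T f => [|l IHl r IHr] f /=; first by move=> _; constructor.
case/and3P => rule /IHl dl /IHr dr; rewrite map_cat -!map_comp.
exact: derives_Node _ _ _ _ _ _ _ rule dl dr.
Qed.

Lemma derives_obeys (T : btree) (a : letter) (w : seq letter) :
  derives T a w ->
  exists f : vertex T -> letter,
    [/\ f (root_vertex T) = a, obeys_grammar f
      & [seq f v | v <- leaf_vertices T] = w].
Proof.
elim=> {T a w} [a|l r a b c u v rule _ [f [fb fo fu]] _ [g [gc go gv]]].
  by exists (fun=> a).
exists (fun x : vertex (Node l r) =>
  match x with None => a | Some (inl y) => f y | Some (inr y) => g y end).
split=> //=; first by rewrite fb gc rule; apply/and3P.
by rewrite map_cat -!map_comp -fu -gv.
Qed.

Lemma parsesP (T : btree) (w : seq letter) :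
  reflect (exists a, derives T a w) (parses T w).
Proof.
apply: (iffP existsP) => [[f /andP[fo /eqP <-]]|[a /derives_obeys[f [_ fo fw]]]].
  by exists (f (root_vertex T)); apply: obeys_derives.
exists [ffun v => f v]; rewrite (obeys_grammar_ext _ _ f) ?fo /=; last exact: ffunE.
by rewrite -fw; apply/eqP/eq_map => v; rewrite ffunE.
Qed.

Lemma nleaves_gt0 (T : btree) : 0 < nleaves T.
Proof. by elim: T => //= l IHl r _; rewrite addn_gt0 IHl. Qed.

Lemma size_derives {T a w} : derives T a w -> size w = nleaves T.
Proof. by elim=> {T a w} //= l r a b c u v _ _ su _ sv; rewrite size_cat su sv. Qed.

Lemma size_parses {T w} : parses T w -> size w = nleaves T.
Proof. by case/parsesP => a /size_derives. Qed.

Lemma derives_perm (s : {perm letter}) T a w :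
  derives T a w -> derives T (s a) (map s w).
Proof.
elim=> {T a w} [a|l r a b c u v rule _ du _ dv]; first exact: derives_Leaf.
by rewrite map_cat; apply: derives_Node _ _ _ _ _ _ _ _ du dv; rewrite is_rule_perm.
Qed.

Lemma parses_perm (s : {perm letter}) T w : parses T (map s w) = parses T w.
Proof.
suff sub (t : {perm letter}) x : parses T x -> parses T (map t x).
  apply/idP/idP => [/(sub s^-1%g)|]; last exact: sub.
  by rewrite mapK //; apply: permK.
by case/parsesP => a /(derives_perm t) d; apply/parsesP; exists (t a).
Qed.

(** * Sizes of word classes *)

Lemma parses_distinct_letters T w : 1 < nleaves T -> parses T w ->
  exists x y, [/\ x \in w, y \in w & x != y].
Proof.
move=> T_gt1 /parsesP[a d]; elim: d T_gt1 => {T a w} //.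
move=> l r a b c u v rule dl IHl dr IHr _.
have [/IHl[x [y [xu yu xy]]]|l_le1] := ltnP 1 (nleaves l).
  by exists x, y; rewrite !mem_cat xu yu.
have [/IHr[x [y [xv yv xy]]]|r_le1] := ltnP 1 (nleaves r).
  by exists x, y; rewrite !mem_cat xv yv !orbT.
(* Both subtrees are now single leaves, so the word is [b] followed by [c], distinct by the rule. *)
have leaf T : nleaves T <= 1 -> T = Leaf.
  by case: T => //= T1 T2; rewrite leqNgt -addn1 leq_add ?nleaves_gt0.
move: dl dr; rewrite (leaf _ l_le1) (leaf _ r_le1).
move=> /derives_LeafE-> /derives_LeafE->; exists b, c.
by move: rule; rewrite is_ruleE !inE !eqxx orbT => /and3P[].
Qed.

(** With three letters, two images leave only one choice for the third. *)
Lemma perm_letter_eq (s t : {perm letter}) (x y : letter) :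
  x != y -> s x = t x -> s y = t y -> s = t.
Proof.
have third (a b c d : letter) :
    a != b -> c != a -> c != b -> d != a -> d != b -> c = d.
  move=> ab ca cb da db; apply/val_inj; move: ab ca cb da db.
  by case: a b c d => [[|[|[|//]]] ?] [[|[|[|//]]] ?] [[|[|[|//]]] ?] [[|[|[|//]]] ?].
move=> xy sx sy; apply/permP => z.
have [->//|zx] := eqVneq z x; have [->//|zy] := eqVneq z y.
apply: (third (s x) (s y)); rewrite ?(inj_eq perm_inj) //.
  by rewrite sx (inj_eq perm_inj).
by rewrite sy (inj_eq perm_inj).
Qed.

Lemma mem_word_class n (w : n.-tuple letter) : w \in word_class w.
Proof.
apply/imsetP; exists 1%g => //; apply/val_inj => /=.
by rewrite (eq_map (@perm1 _)) map_id.
Qed.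

Lemma word_class_perm n (w : n.-tuple letter) (s : {perm letter}) :
  word_class (map_tuple s w) = word_class w.
Proof.
have mapM (t u : {perm letter}) (x : seq letter) :
    map u (map t x) = map (t * u)%g x.
  by rewrite -map_comp; apply: eq_map => z; rewrite /= permM.
apply/setP => x; apply/imsetP/imsetP => -[t _ ->].
  by exists (s * t)%g => //; apply/val_inj; rewrite /= mapM.
by exists (s^-1 * t)%g => //; apply/val_inj; rewrite /= mapM mulKVg.
Qed.

Lemma card_word_class n (w : n.-tuple letter) (x y : letter) :
  x \in w -> y \in w -> x != y -> #|word_class w| = 6.
Proof.
move=> xw yw xy; rewrite card_imset.
  (* Here 6 is the order of the symmetric group on the alphabet. *)
  by rewrite -[6]/(3`!) -card_Sn; apply: eq_card.
move=> s t /(congr1 val) /= /eq_in_map st.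
by apply: (perm_letter_eq _ _ _ _ xy); apply: st.
Qed.

(** The length is a free parameter, so that words of an extended tree can be typed with length
    [n.+1], which [nleaves (attach T i)] equals only propositionally. *)
Definition common_words n (S1 S2 : btree) : {set n.-tuple letter} :=
  [set w : n.-tuple letter | common_parse_word S1 S2 w].

(** The common words are partitioned by their classes. The bound on [n] matters: the words of length
    1 form one class of three elements. *)
Lemma card_common_words n (S1 S2 : btree) : nleaves S1 = n -> 1 < n ->
  #|common_words n S1 S2| =
  6 * #|[set word_class w | w in common_words n S1 S2]|.
Proof.
move=> S1n n_gt1; rewrite -sum1_card (partition_big_imset (@word_class n)) /=.
rewrite mulnC -sum_nat_const; apply: eq_bigr => _ /imsetP[w Ww ->].
have [x [y [xw yw xy]]] : exists x y, [/\ x \in w, y \in w & x != y].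
  apply: (parses_distinct_letters S1); first by rewrite S1n.
  by move: Ww; rewrite inE => /andP[].
rewrite sum1_card -(card_word_class _ _ _ _ xw yw xy); apply: eq_card => v.
(* The fibre over the class of [w] is the whole class, since parsing is invariant under letter
   permutations. *)
apply/andP/idP => [[_ /eqP <-]|/imsetP[s _ ->]]; first exact: mem_word_class.
rewrite word_class_perm eqxx; split=> //; move: Ww.
by rewrite !inE /common_parse_word /= !parses_perm.
Qed.

(** * Expanding one letter of a word *)

(** The successor and predecessor modulo 3 are the two letters other than [c]; [b] chooses their
    order. *)
Definition rule_rhs (c : letter) (b : bool) : seq letter :=
  if b then [:: ordS c; ord_pred c] else [:: ord_pred c; ordS c].

Lemma rule_rhsP c x y : reflect (exists b, rule_rhs c b = [:: x; y]) (is_rule c x y).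
Proof.
apply: (iffP idP) => [|[b]].
  have eqE (p q : letter) : p = q :> nat -> p = q by apply: val_inj.
  case: c x y => [[|[|[|//]]] ?] [[|[|[|//]]] ?] [[|[|[|//]]] ?] // _;
  by [exists true; congr [:: _; _]; apply: eqE |
      exists false; congr [:: _; _]; apply: eqE].
by case: b => -[<- <-]; case: c => [[|[|[|//]]] ?].
Qed.

Lemma rule_rhs_inj c d b e : rule_rhs c b = rule_rhs d e -> c = d /\ b = e.
Proof.
suff h : rule_rhs c b == rule_rhs d e -> (c == d) && (b == e).
  by move=> /eqP /h /andP[/eqP-> /eqP->].
by case: c d b e => [[|[|[|//]]] ?] [[|[|[|//]]] ?] [] [].
Qed.

(* Positions are counted from 0 here, so that leaf [i] is position [i.-1]. *)
Definition expand (j : nat) (b : bool) (w : seq letter) : seq letter :=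
  take j w ++ rule_rhs (nth ord0 w j) b ++ drop j.+1 w.

Lemma size_rule_rhs c b : size (rule_rhs c b) = 2.
Proof. by case: b. Qed.

Lemma size_expand j b w : j < size w -> size (expand j b w) = (size w).+1.
Proof.
move=> jw; rewrite !size_cat size_rule_rhs size_take jw size_drop.
by rewrite addnCA add2n -[in RHS](subnKC jw) addSn.
Qed.

Lemma expand_cat j b u v :
  expand j b (u ++ v) =
  if j < size u then expand j b u ++ v else u ++ expand (j - size u) b v.
Proof.
rewrite /expand take_cat nth_cat drop_cat; case: ltnP => ju; last first.
  by rewrite ltnNge leqW //= subSn // -!catA.
rewrite -!catA; case: ltnP => // uj.
(* Boundary case: the expanded letter is the last one of [u]. *)
have -> : j.+1 = size u by apply/eqP; rewrite eqn_leq ju.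
by rewrite subnn drop0 drop_size.
Qed.

(** Equal sizes align the prefix, the two-letter block and the suffix; the block determines the
    letter it replaces (the one missing from it) and the order. *)
Lemma expand_inj j b e w x : size w = size x -> j < size w ->
  expand j b w = expand j e x -> w = x /\ b = e.
Proof.
move=> wx jw /eqP; rewrite eqseq_cat ?size_take -?wx // eqseq_cat ?size_rule_rhs //.
case/and3P => /eqP tk /eqP/rule_rhs_inj[cc ->] /eqP dr; split=> //.
rewrite -[w](cat_take_drop j) -[x](cat_take_drop j) tk.
have jx : j < size x by rewrite -wx.
by rewrite (drop_nth ord0 jw) (drop_nth ord0 jx) cc dr.
Qed.

(** * Expansion of words against attachment of trees *)

Lemma derives_expand T a w i b : derives T a w -> 0 < i <= nleaves T ->
  derives (attach T i) a (expand i.-1 b w).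
Proof.
move=> d; elim: d i => {T a w} [a|l r a c d u v rule dl IHl dr IHr] i.
  rewrite -eqn_leq eq_sym => /eqP->.
  rewrite /expand /= cats0.
  have [x [y xy]] : exists x y, rule_rhs a b = [:: x; y].
    by case: b; [exists (ordS a), (ord_pred a) | exists (ord_pred a), (ordS a)].
  rewrite xy -[[:: x; y]]/([:: x] ++ [:: y]).
  apply: (derives_Node _ _ _ x y); try exact: derives_Leaf.
  by apply/rule_rhsP; exists b.
case/andP => i_gt0 ile /=; rewrite expand_cat prednK // (size_derives dl).
(* Leaf [i] lies in [l] exactly when position [i.-1] lies in [u], so [attach] and [expand] descend
   into the same side. *)
case: leqP => il.
  by apply: derives_Node _ _ _ _ _ _ _ rule _ dr; apply: IHl; rewrite i_gt0.
apply: derives_Node _ _ _ _ _ _ _ rule dl _; rewrite -!subn1 subnAC subn1.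
by apply: IHr; rewrite subn_gt0 il leq_subLR.
Qed.

(** Deleting the two attached leaves turns their parent into a leaf, whose label is the letter to
    restore. *)
Lemma derives_attach T a w i : 0 < i <= nleaves T -> derives (attach T i) a w ->
  exists b v, derives T a v /\ w = expand i.-1 b v.
Proof.
elim: T a w i => [|l IHl r IHr] a w i /=.
  rewrite -eqn_leq eq_sym => /eqP-> /= /derives_NodeE[x [y [u [v]]]].
  case=> /rule_rhsP[b xy] /derives_LeafE-> /derives_LeafE-> ->.
  exists b, [:: a]; split; first exact: derives_Leaf.
  by rewrite /expand /= cats0 xy.
case/andP => i_gt0 ile.
case: leqP => il /derives_NodeE[x [y [u [v [rule dl dr ->]]]]].
  have [|b [u' [du' ->]]] := IHl _ _ _ _ dl; first by rewrite i_gt0.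
  exists b, (u' ++ v); split; first exact: derives_Node _ _ _ _ _ _ _ rule du' dr.
  by rewrite expand_cat prednK // (size_derives du') il.
have [|b [v' [dv' ->]]] := IHr _ _ _ _ dr.
  by rewrite subn_gt0 il leq_subLR.
exists b, (u ++ v'); split; first exact: derives_Node _ _ _ _ _ _ _ rule dl dv'.
rewrite expand_cat prednK // (size_derives dl) leqNgt il /=.
by rewrite -!subn1 subnAC.
Qed.

Lemma parses_expand T w i b : 0 < i <= nleaves T -> parses T w ->
  parses (attach T i) (expand i.-1 b w).
Proof.
move=> iT /parsesP[a d]; apply/parsesP; exists a; exact: derives_expand.
Qed.

Lemma parses_attach T w i : 0 < i <= nleaves T -> parses (attach T i) w ->
  exists b v, parses T v /\ w = expand i.-1 b v.
Proof.
move=> iT /parsesP[a /(derives_attach _ _ _ _ iT)[b [v [d ->]]]].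
by exists b, v; split=> //; apply/parsesP; exists a.
Qed.

Lemma nleaves_attach T i : 0 < i <= nleaves T -> nleaves (attach T i) = (nleaves T).+1.
Proof.
elim: T i => [|l IHl r IHr] i /=; first by rewrite -eqn_leq eq_sym => /eqP->.
case/andP => i_gt0 ile; case: leqP => il /=; first by rewrite IHl ?i_gt0.
by rewrite IHr ?addnS // subn_gt0 il leq_subLR.
Qed.

Lemma common_parse_word_attach S1 S2 w i :
  nleaves S1 = nleaves S2 -> 0 < i <= nleaves S1 ->
  common_parse_word (attach S1 i) (attach S2 i) w <->
  exists b v, common_parse_word S1 S2 v /\ w = expand i.-1 b v.
Proof.
move=> S12 i1; have i2 : 0 < i <= nleaves S2 by rewrite -S12.
split=> [/andP[/(parses_attach _ _ _ i1)[b [v [p1 ->]]]]|[b [v [/andP[p1 p2] ->]]]].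
  (* Each tree yields its own contracted word; injectivity of expansion at a common position makes
     the two equal. *)
  case/(parses_attach _ _ _ i2) => e [x [p2 vx]].
  have [|| vx' _] := expand_inj _ _ _ _ _ _ _ vx.
  - by rewrite (size_parses p1) (size_parses p2).
  - by rewrite (size_parses p1); case/andP: i1 => /prednK->.
  by exists b, v; split=> //; rewrite /common_parse_word p1 vx' p2.
by apply/andP; split; apply: parses_expand.
Qed.

(** * Counting words, then classes *)

Lemma card_common_words_attach S1 S2 n i :
  nleaves S1 = n -> nleaves S2 = n -> 0 < i <= n ->
  #|common_words n.+1 (attach S1 i) (attach S2 i)| = 2 * #|common_words n S1 S2|.
Proof.
move=> S1n S2n i_n.
have in' : i.-1 < n by case/andP: i_n => /prednK->.
have S12 : nleaves S1 = nleaves S2 by rewrite S1n.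
have i1 : 0 < i <= nleaves S1 by rewrite S1n.
have sz (b : bool) (w : n.-tuple letter) : size (expand i.-1 b w) == n.+1.
  by rewrite size_expand size_tuple.
(* The factor 2 is the choice of order: [F] is injective and maps the pairs of a common word and a
   boolean onto the common words of the extended trees. *)
pose F (p : n.-tuple letter * bool) := Tuple (sz p.2 p.1).
have F_inj : injective F.
  move=> [w b] [x e] /(congr1 val) /= /expand_inj[||wx ->]; rewrite ?size_tuple //.
  by rewrite (val_inj wx).
have -> : 2 * #|common_words n S1 S2| =
    #|setX (common_words n S1 S2) [set: bool]|.
  by rewrite cardsX cardsT card_bool mulnC.
rewrite -(card_imset _ F_inj).
apply: eq_card => w; rewrite inE; apply/idP/imsetP.
  case/(common_parse_word_attach _ _ _ _ S12 i1) => b [v [cv wE]].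
  have sv : size v == n by case/andP: cv => /size_parses->; rewrite S1n.
  by exists (Tuple sv, b); [rewrite !inE andbT | apply/val_inj].
case=> -[v b]; rewrite !inE andbT /= => cv ->.
by apply/(common_parse_word_attach _ _ _ _ S12 i1); exists b, v.
Qed.

Lemma card_ParseWords S1 S2 n : nleaves S1 = n ->
  #|ParseWords S1 S2| = #|[set word_class w | w in common_words n S1 S2]|.
Proof.
move=> <-; congr #|pred_of_set _|; apply: eq_imset_p.
Qed.

Theorem proposition10 (n i : nat) (T1' T2' : btree)
    (hT1' : nleaves T1' = n) (hT2' : nleaves T2' = n)
    (hi : 1 <= i <= n)
    (hcommon : exists w : seq letter, common_parse_word T1' T2' w) :
  (2 <= n ->
     #|ParseWords (attach T1' i) (attach T2' i)| = 2 * #|ParseWords T1' T2'|)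
  /\ (exists w : seq letter,
        common_parse_word (attach T1' i) (attach T2' i) w).
Proof.
have iT : 0 < i <= nleaves T1' by rewrite hT1'.
have aT : nleaves (attach T1' i) = n.+1 by rewrite nleaves_attach ?hT1'.
split=> [n_gt1|].
  apply/eqP; rewrite (card_ParseWords _ _ _ aT) (card_ParseWords _ _ _ hT1').
  (* Multiplying by 6 turns both class counts into word counts. *)
  rewrite -(eqn_pmul2l (isT : 0 < 6)) -(card_common_words _ _ _ aT) ?(leqW n_gt1) //.
  by rewrite mulnCA -(card_common_words _ _ _ hT1') // card_common_words_attach.
(* Either order would do as witness. *)
case: hcommon => w cw; exists (expand i.-1 true w).
by apply/common_parse_word_attach; rewrite ?hT1' ?hT2' //; exists true, w.
Qed.
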